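(* Let $G=U(1)\leftthreetimes\mathbb{R}^2$ be the continuum magnetic translation group and $\mathcal{C}_G^\times$ a $G$-crossed braided tensor category extending a unitary modular tensor category $\mathcal{C}_{\mathbf 0}$, such that $G$ does not permute the anyons, with symmetry fractionalization class determined by the vison $v\in\mathcal{A}$. Let $n\ge1$, $\mathbf g=(e^{2\pi i/n},\mathbf 0)$, and let $0_{\mathbf g}$ be an Abelian $\mathbf g$-defect with $(0_{\mathbf g})^n=v$. Let $\mathbf x,\mathbf y\in\mathbb{R}^2$ be translations spanning a magnetic unit cell, i.e. $\mathbf x\times\mathbf y=l_B^2$. Define the Hall conductivity and the filling modulo 1 by $$e^{2\pi i\bar\sigma_H}:=\mathcal{I}_n(0_{\mathbf g})^{2n},\qquad e^{2\pi i\nu}:=\left(\frac{\eta_{0_{\mathbf g}}(\mathbf x,\mathbf y)}{\eta_{0_{\mathbf g}}(\mathbf y,\mathbf x)}\right)^n .$$ Then $$e^{2\pi i\nu}=M_{v,v}=e^{2\pi i\bar\sigma_H}.$$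
   Context: $U(1)\leftthreetimes\mathbb{R}^2$: pairs $(e^{2\pi i z},\mathbf r)$ with product $(e^{2\pi i z_1},\mathbf r_1)(e^{2\pi i z_2},\mathbf r_2)=(e^{2\pi i(z_1+z_2+\frac{\mathbf r_1\times\mathbf r_2}{2l_B^2})},\mathbf r_1+\mathbf r_2)$, $\mathbf r_1\times\mathbf r_2=x_1y_2-y_1x_2$. A vector $\mathbf r$ also denotes the element $(1,\mathbf r)$. $\mathcal{C}_{\mathbf 0}$ is a unitary modular tensor category (simple objects: ''anyons''); $\mathcal{A}$ is the finite Abelian group of Abelian (quantum dimension 1) anyons; $M_{a,b}=R^{a,b}R^{b,a}$ for $b\in\mathcal{A}$; $\theta_a$ is the topological twist ($\theta_a=R^{a,a}$ for Abelian anyons and Abelian defects). $\mathbf 0$ also denotes the identity of $G$, $\bar{\mathbf g}=\mathbf g^{-1}$. $\mathcal{I}_n(0_{\mathbf g})=\theta_{0_{\mathbf g}}^n\prod_{j=0}^{n-1}\eta_{0_{\mathbf g}}(\mathbf g,\mathbf g^j)$. A $G$-crossed braided tensor category (BTC) $\mathcal{C}_G^\times=\bigoplus_{\mathbf g\in G}\mathcal{C}_{\mathbf g}$ is a $G$-graded unitary fusion-type category with trivial component $\mathcal{C}_{\mathbf 0}$, a $G$-action $x\mapsto{}^{\mathbf k}x$ mapping $\mathcal{C}_{\mathbf g}\to\mathcal{C}_{\mathbf{kgk}^{-1}}$, and a $G$-crossed braiding ($c_{\mathbf k}\times a_{\mathbf g}={}^{\mathbf k}a_{\mathbf g}\times c_{\mathbf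 k}$). Simple objects of $\mathcal{C}_{\mathbf g}$ are called $\mathbf g$-defects; a defect is Abelian if it has quantum dimension 1. Skeletally it is given by data $\{F,R,U,\eta\}$: $F$-symbols satisfying the pentagon equation; $G$-crossed $R$-symbols; phases/matrices $U_{\mathbf k}(a,b;c)$ for the action of $\mathbf k$ on splitting spaces; phases $\eta_x(\mathbf g,\mathbf h)$ relating the action of $\mathbf{gh}$ to the composition of the actions, with $U_{\mathbf 0}=1$, $\eta_0=1$, $\eta_x(\mathbf g,\mathbf 0)=\eta_x(\mathbf 0,\mathbf h)=1$. For Abelian objects subscripts are dropped, and for $a\in\mathcal{C}_{\mathbf g},b\in\mathcal{C}_{\mathbf h},c\in\mathcal{C}_{\mathbf k}$ the consistency equations read $R^{a,c}F^{a,c,{}^{\bar{\mathbf k}}b}R^{b,c}=F^{c,{}^{\bar{\mathbf k}}a,{}^{\bar{\mathbf k}}b}\,U_{\mathbf k}(a,b)\,R^{ab,c}F^{a,b,c}$, $(R^{c,a})^{-1}F^{a,{}^{\bar{\mathbf g}}c,b}(R^{{}^{\bar{\mathbf g}}c,b})^{-1}=F^{c,a,b}\,\eta_c(\mathbf g,\mathbf h)\,(R^{c,ab})^{-1}F^{a,b,{}^{\bar{\mathbf h}\bar{\mathbf g}}c}$, $\eta_x(\mathbf g,\mathbf h)\eta_x(\mathbf{gh},\mathbf k)=\eta_{{}^{\bar{\mathbf g}}x}(\mathbf h,\mathbf k)\eta_x(\mathbf g,\mathbf{hk})$, $\eta_a(\mathbf k,\mathbf l)\eta_b(\mathbf k,\mathbf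 l)U_{\mathbf l}({}^{\bar{\mathbf k}}a,{}^{\bar{\mathbf k}}b)U_{\mathbf k}(a,b)=U_{\mathbf{kl}}(a,b)\eta_{ab}(\mathbf k,\mathbf l)$, and the $G$-crossed ribbon property $R^{b,{}^{\bar{\mathbf h}}a}R^{a,b}=\frac{\theta_{ab}}{\theta_a\theta_b}\frac{U_{\mathbf{gh}}(a,b)}{\eta_a(\mathbf g,\mathbf h)\eta_b(\mathbf h,\bar{\mathbf h}\mathbf{gh})}$. Since $G$ acts trivially on anyons, each $\mathcal{C}_{\mathbf k}$ contains an Abelian defect; once one, $0_{\mathbf k}$, is chosen for each $\mathbf k$ ($0_{\mathbf 0}$ trivial), $0_{\mathbf k}\times0_{\mathbf l}=\mathfrak{w}(\mathbf k,\mathbf l)\times0_{\mathbf{kl}}$ with $\mathfrak{w}$ an $\mathcal{A}$-valued 2-cocycle. Symmetry fractionalization class determined by $v$ means: $\mathfrak{w}$ is cohomologous to the cocycle $\mathfrak{w}_v(\mathbf g_1,\mathbf g_2)=v^{\,c-[c]}$, $c=z_1+z_2+\frac{\mathbf r_1\times\mathbf r_2}{2l_B^2}$, where $\mathbf g_i=(e^{2\pi i z_i},\mathbf r_i)$ with $z_i\in[0,1)$ and $[c]\in[0,1)$ is the fractional part of $c$ (every class in $\mathcal{H}^2(G,\mathcal{A})\cong\mathcal{A}$ is of this form). *)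

(* Defs.v *)
From HB Require Import structures.
From mathcomp Require Import all_boot all_order all_algebra.
From mathcomp Require Import all_classical all_reals all_analysis.
From mathcomp Require Import complex ring.

Set Implicit Arguments.
Unset Strict Implicit.
Unset Printing Implicit Defensive.

Import Order.TTheory GRing.Theory Num.Theory.

Local Open Scope ring_scope.
Local Open Scope complex_scope.

(** * Phases *)

Section Phases.
Context {R : realType}.

Definition expi (t : R) : R[i] := cos (2 * pi * t) +i* sin (2 * pi * t).

(* The representative modulo 1 of [log z / (2 pi i)], meaningful for [|z| = 1]. *)
Definition arg01 (z : R[i]) : R :=
  xget 0 [set t : R | 0 <= t < 1 /\ expi t = z]%classic.

Lemma expiD (s t : R) : expi (s + t) = expi s * expi t.
Proof.
rewrite /expi mulrDr cosD sinD; apply/eqP.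
by rewrite eq_complex /= eqxx /= addrC mulrC [X in _ + X]mulrC addrC mulrC eqxx.
Qed.

Lemma expi0 : expi 0 = 1.
Proof. by rewrite /expi mulr0 cos0 sin0. Qed.

Lemma normc_expi (t : R) : `|expi t| = 1.
Proof. by rewrite /expi normc_def /= cos2Dsin2 sqrtr1. Qed.

End Phases.

(** * The continuum magnetic translation group *)

Section MagneticTranslations.
Variable R : realType.

Definition circle : Type := {z : R[i] | `|z| == 1}.
HB.instance Definition _ := Choice.on circle.

Definition cross (r s : R * R) : R := r.1 * s.2 - s.1 * r.2.

Definition magtrans (lB : R) : Type := (circle * (R * R))%type.

Section Group.
Variable lB : R.
Local Notation T := (magtrans lB).
HB.instance Definition _ := Choice.on T.

Lemma circle_expiP (t : R) : `|expi t| == 1.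
Proof. by rewrite normc_expi. Qed.
Definition circle_expi (t : R) : circle := exist _ (expi t) (circle_expiP t).

Definition cocycle_phase (r s : R * R) : R := cross r s / (2 * lB ^+ 2).

Lemma mt_mul_phaseP (g h : T) :
  `|val g.1 * val h.1 * expi (cocycle_phase g.2 h.2)| == 1.
Proof.
by rewrite !normrM normc_expi (eqP (valP g.1)) (eqP (valP h.1)) !mulr1.
Qed.
Definition mt_mul (g h : T) : T :=
  (exist _ (val g.1 * val h.1 * expi (cocycle_phase g.2 h.2))
     (mt_mul_phaseP g h), g.2 + h.2).

Definition mt_one : T := (circle_expi 0, 0).

Lemma mt_inv_phaseP (g : T) : `|(val g.1)^-1| == 1.
Proof. by rewrite normfV (eqP (valP g.1)) invr1. Qed.
Definition mt_inv (g : T) : T := (exist _ (val g.1)^-1 (mt_inv_phaseP g), - g.2).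

Lemma circle_neq0 (u : circle) : val u != 0.
Proof. by rewrite -normr_eq0 (eqP (valP u)) oner_eq0. Qed.

Lemma mt_eqP (g h : T) : val g.1 = val h.1 -> g.2 = h.2 -> g = h.
Proof. by case: g h => [u r] [w s] /= /val_inj -> ->. Qed.

Lemma mt_mulA : associative mt_mul.
Proof.
move=> [u [x1 y1]] [w [x2 y2]] [z [x3 y3]]; apply: mt_eqP; last exact: addrA.
rewrite /= -!mulrA; congr (_ * (_ * _)).
rewrite [RHS]mulrCA; congr (_ * _); rewrite -!expiD; congr expi.
rewrite /cocycle_phase /cross /= -!mulrDl; congr (_ / _); ring.
Qed.

Lemma mt_mul1 : left_id mt_one mt_mul.
Proof.
move=> g; apply: mt_eqP; last exact: add0r.
rewrite /= expi0 mul1r /cocycle_phase /cross /= mul0r mulr0 subrr mul0r.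
by rewrite expi0 mulr1.
Qed.

Lemma mt_mulr1 : right_id mt_one mt_mul.
Proof.
move=> g; apply: mt_eqP; last exact: addr0.
rewrite /= expi0 mulr1 /cocycle_phase /cross /= mul0r mulr0 subrr mul0r.
by rewrite expi0 mulr1.
Qed.

Lemma mt_mulV : left_inverse mt_one mt_inv mt_mul.
Proof.
move=> g; apply: mt_eqP; last exact: addNr.
rewrite /= mulVf ?circle_neq0 // mul1r; congr expi.
by rewrite /cocycle_phase /cross /= mulrN mulNr opprK addrC subrr mul0r.
Qed.

Lemma mt_mulrV : right_inverse mt_one mt_inv mt_mul.
Proof.
move=> g; apply: mt_eqP; last exact: addrN.
rewrite /= mulfV ?circle_neq0 // mul1r; congr expi.
by rewrite /cocycle_phase /cross /= mulrN mulNr opprK addrC subrr mul0r.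
Qed.

HB.instance Definition _ := @isGroup.Build T
  mt_one mt_inv mt_mul mt_mulA mt_mul1 mt_mulr1 mt_mulV mt_mulrV.

Definition mt_rot (t : R) : T := (circle_expi t, 0).

Definition mt_transl (r : R * R) : T := (circle_expi 0, r).

End Group.
End MagneticTranslations.

(** * Skeletal G-crossed braided tensor categories *)

(* The simple objects of all sectors form one type [obj], graded by [deg];
   [sect g] lists those of degree [g].  The splitting space V(a,b;c) has
   dimension [N a b c] and a fixed orthonormal basis indexed by ['I_(N a b c)].
   The symbols take natural numbers as basis labels, and only their values on
   labels in range are meaningful; ordinals coerce to naturals below.

   Conventions, where |a,b;c,m> is the m-th basis vector of V(a,b;c) and
   ^{k^-1}a is the image of a under k^-1:
     |a,b;e,i>|e,c;d,j> = sum_(f,m,n) F a b c d e i j f m n |b,c;f,m>|a,f;d,n>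
     |b,^{h^-1}a;c,m>   = sum_n Rs a b c m n |a,b;c,n>             (deg b = h)
     rho_k |^{k^-1}a,^{k^-1}b;^{k^-1}c,m> = sum_n U k a b c m n |a,b;c,n> *)
Record gxdata (R : realType) (G : groupType) := GXData {
  obj : eqType;
  deg : obj -> G;
  sect : G -> seq obj;
  vac : obj;
  dual : obj -> obj;
  N : obj -> obj -> obj -> nat;
  act : G -> obj -> obj;
  F : obj -> obj -> obj -> obj ->
      obj -> nat -> nat -> obj -> nat -> nat -> R[i];
  Rs : obj -> obj -> obj -> nat -> nat -> R[i];
  U : G -> obj -> obj -> obj -> nat -> nat -> R[i];
  eta : obj -> G -> G -> R[i]
}.

Section Theory.
Context {R : realType} {G : groupType} (D : gxdata R G).
Local Notation C := R[i].
Local Notation X := (obj D).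
Local Notation iact k a := (act (k^-1)%g a).
Implicit Types (a b c d e f x : X) (g h k l : G).

(* The modulus of F^{a abar a}_a at the vacuum channels is 1/d_a. *)
Definition qdim a : C :=
  `|F a (dual a) a a (vac D) 0 0 (vac D) 0 0|^-1.

Definition twist a : C :=
  \sum_(c <- sect D (deg a * deg a)%g) \sum_(m < N a a c)
    qdim c / qdim a * Rs a a c m m.

(* [A] restricted to indices i < p, j < q is a unitary matrix *)
Definition unitary_on (p q : nat) (A : nat -> nat -> C) : Prop :=
  (forall i i' : 'I_p, \sum_(j < q) A i j * (A i' j)^* = (i == i')%:R) /\
  (forall j j' : 'I_q, \sum_(i < p) (A i j)^* * A i j' = (j == j')%:R).

Record fusion_axioms : Prop := {
  sect_uniq : forall g, uniq (sect D g);
  mem_sect : forall g a, (a \in sect D g) = (deg a == g);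
  sect_neq0 : forall g, sect D g != [::];
  deg_vac : deg (vac D) = 1%g;
  N_deg : forall a b c, (0 < N a b c)%N -> deg c = (deg a * deg b)%g;
  N_vacl : forall a b, N (vac D) a b = (a == b);
  N_vacr : forall a b, N a (vac D) b = (a == b);
  N_dual : forall a b, N a b (vac D) = (b == dual a);
  dualK : forall a, dual (dual a) = a;
  N_assoc : forall a b c d,
    (\sum_(e <- sect D (deg a * deg b)%g) N a b e * N e c d =
     \sum_(f <- sect D (deg b * deg c)%g) N b c f * N a f d)%N
}.

Record F_axioms : Prop := {
  F_unitaryl : forall a b c d e e' (i : 'I_(N a b e)) (j : 'I_(N e c d))
      (i' : 'I_(N a b e')) (j' : 'I_(N e' c d)),
    \sum_(f <- sect D (deg b * deg c)%g)
      \sum_(m < N b c f) \sum_(n < N a f d)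
        F a b c d e i j f m n * (F a b c d e' i' j' f m n)^*
    = ((e == e') && (i == i' :> nat) && (j == j' :> nat))%:R;
  F_unitaryr : forall a b c d f f' (m : 'I_(N b c f)) (n : 'I_(N a f d))
      (m' : 'I_(N b c f')) (n' : 'I_(N a f' d)),
    \sum_(e <- sect D (deg a * deg b)%g)
      \sum_(i < N a b e) \sum_(j < N e c d)
        (F a b c d e i j f m n)^* * F a b c d e i j f' m' n'
    = ((f == f') && (m == m' :> nat) && (n == n' :> nat))%:R;
  F_vac1 : forall b c d (j m : 'I_(N b c d)),
    F (vac D) b c d b 0 j d m 0 = (j == m)%:R;
  F_vac2 : forall a c d (j n : 'I_(N a c d)),
    F a (vac D) c d a 0 j c 0 n = (j == n)%:R;
  F_vac3 : forall a b d (i n : 'I_(N a b d)),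
    F a b (vac D) d d i 0 b 0 n = (i == n)%:R;
  pentagon : forall a b c d e (f g k l : X)
      (i : 'I_(N a b f)) (j : 'I_(N f c g)) (s : 'I_(N g d e))
      (p : 'I_(N c d l)) (q : 'I_(N b l k)) (r : 'I_(N a k e)),
    \sum_(t < N f l e) F f c d e g j s l p t * F a b l e f i t k q r
    = \sum_(x <- sect D (deg b * deg c)%g)
        \sum_(u < N b c x) \sum_(w < N a x g) \sum_(z < N x d k)
          F a b c g f i j x u w * F a x d e g w s k z r * F b c d k x u z l p q
}.

(* Consequences of unitarity, which force [qdim] to be the dimension function
   of the unitary spherical structure. *)
Record dimension_axioms : Prop := {
  qdim_gt0 : forall a, 0 < qdim a;
  qdim_dual : forall a, qdim (dual a) = qdim a;
  qdimM : forall a b,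
    qdim a * qdim b =
    \sum_(c <- sect D (deg a * deg b)%g) (N a b c)%:R * qdim c
}.

(* [eta_cocycle], [U_eta] and [U_F] say that G acts by monoidal functors. *)
Record action_axioms : Prop := {
  act1 : forall x, act 1%g x = x;
  actM : forall k l x, act (k * l)%g x = act k (act l x);
  deg_act : forall k x, deg (act k x) = (k * deg x * k^-1)%g;
  N_act : forall k a b c, N (act k a) (act k b) (act k c) = N a b c;
  U_unitary : forall k a b c,
    unitary_on (N (iact k a) (iact k b) (iact k c)) (N a b c) (U k a b c);
  U_1 : forall a b c (m n : 'I_(N a b c)), U 1%g a b c m n = (m == n)%:R;
  eta_phase : forall x g h, `|eta x g h| = 1;
  eta_vac : forall g h, eta (vac D) g h = 1;
  eta_1r : forall x g, eta x g 1%g = 1;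
  eta_1l : forall x h, eta x 1%g h = 1;
  eta_cocycle : forall x g h k,
    eta x g h * eta x (g * h)%g k = eta (iact g x) h k * eta x g (h * k)%g;
  U_eta : forall k l a b c
      (m : 'I_(N (iact (k * l) a) (iact (k * l) b) (iact (k * l) c)))
      (n : 'I_(N a b c)),
    \sum_(t < N (iact k a) (iact k b) (iact k c))
      eta a k l * eta b k l
        * U l (iact k a) (iact k b) (iact k c) m t * U k a b c t n
    = U (k * l)%g a b c m n * eta c k l;
  U_F : forall k a b c d e f
      (i : 'I_(N (iact k a) (iact k b) (iact k e)))
      (j : 'I_(N (iact k e) (iact k c) (iact k d)))
      (m : 'I_(N b c f)) (n : 'I_(N a f d)),
    \sum_(i' < N a b e) \sum_(j' < N e c d)
      U k a b e i i' * U k e c d j j' * F a b c d e i' j' f m n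
    = \sum_(m' < N (iact k b) (iact k c) (iact k f))
        \sum_(n' < N (iact k a) (iact k f) (iact k d))
          F (iact k a) (iact k b) (iact k c) (iact k d)
            (iact k e) i j (iact k f) m' n'
          * U k b c f m' m * U k a f d n' n
}.

(* Since [Rs] is unitary, its inverse is the conjugate transpose; this is how
   the inverse braiding is written in [heptagon2]. *)
Record braiding_axioms : Prop := {
  R_unitary : forall a b c,
    unitary_on (N b (iact (deg b) a) c) (N a b c) (Rs a b c);
  R_vacl : forall a, Rs (vac D) a a 0 0 = 1;
  R_vacr : forall a, Rs a (vac D) a 0 0 = 1;
  heptagon1 : forall a b c d e (g : X), let k := deg c in
    forall (i : 'I_(N c (iact k a) e)) (j : 'I_(N e (iact k b) d))
      (m : 'I_(N b c g)) (n : 'I_(N a g d)),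
    \sum_(p < N a c e) \sum_(q < N c (iact k b) g)
      Rs a c e i p * F a c (iact k b) d e p j g q n * Rs b c g q m
    = \sum_(f <- sect D (deg a * deg b)%g)
        \sum_(s < N (iact k a) (iact k b) (iact k f))
        \sum_(t < N c (iact k f) d)
        \sum_(u < N a b f) \sum_(w < N f c d)
          F c (iact k a) (iact k b) d e i j (iact k f) s t
          * U k a b f s u * Rs f c d t w * F a b c d f u w g m n;
  heptagon2 : forall a b c d e x,
    let g := deg a in let h := deg b in let c' := iact (g * h) c in
    forall (i : 'I_(N c a e)) (j : 'I_(N e b d))
      (m : 'I_(N b c' x)) (n : 'I_(N a x d)),
    \sum_(p < N a (iact g c) e) \sum_(q < N (iact g c) b x)
      (Rs c a e p i)^* * F a (iact g c) b d e p j x q n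
        * (Rs (iact g c) b x m q)^*
    = \sum_(f <- sect D (g * h)%g)
        \sum_(s < N a b f) \sum_(t < N c f d) \sum_(w < N f c' d)
          F c a b d e i j f s t * eta c g h * (Rs c f d w t)^*
          * F a b c' d f s w x m n;
  (* invariance of the braiding under the action of [k] *)
  R_act : forall k a b c, let h := deg b in
    forall (m : 'I_(N (iact k b) (iact k (iact h a)) (iact k c)))
      (n : 'I_(N a b c)),
    \sum_(t < N (iact k a) (iact k b) (iact k c))
      Rs (iact k a) (iact k b) (iact k c) m t * U k a b c t n
        * eta a k (k^-1 * h * k)%g
    = \sum_(t < N b (iact h a) c)
        U k b (iact h a) c m t * Rs a b c t n * eta a h k;
  ribbon : forall a b c, let g := deg a in let h := deg b in
    forall (m : 'I_(N (iact h a) (iact (h^-1 * g * h) b) c))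
      (n : 'I_(N a b c)),
    \sum_(t < N b (iact h a) c) Rs b (iact h a) c m t * Rs a b c t n
    = twist c / (twist a * twist b)
      * (U (g * h)%g a b c m n
         / (eta a g h * eta b h (h^-1 * g * h)%g))
}.

Record gcrossed_btc : Prop := {
  gx_fusion : fusion_axioms;
  gx_F : F_axioms;
  gx_dim : dimension_axioms;
  gx_action : action_axioms;
  gx_braiding : braiding_axioms
}.

(* The S-matrix of the trivial sector, without its positive normalization. *)
Definition Smatrix : 'M[C]_(size (sect D 1%g)) :=
  \matrix_(i, j)
    let a := nth (vac D) (sect D 1%g) i in
    let b := nth (vac D) (sect D 1%g) j in
    \sum_(c <- sect D 1%g)
      (N a (dual b) c)%:R * (twist c / (twist a * twist b)) * qdim c.

Definition modular : Prop := Smatrix \in unitmx.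

Definition abelian a : bool := qdim a == 1.

Definition abelian_anyon a : bool := (deg a == 1%g) && abelian a.

(* The unique fusion channel, when [a] or [b] is Abelian. *)
Definition fprod a b : X :=
  head (vac D) [seq c <- sect D (deg a * deg b)%g | (0 < N a b c)%N].

Definition fpow a (m : int) : X :=
  match m with
  | Posz n => iter n (fprod a) (vac D)
  | Negz n => iter n.+1 (fprod (dual a)) (vac D)
  end.

Definition Rab a b : C := Rs a b (fprod a b) 0 0.

Definition monodromy a b : C := Rab a b * Rab b a.

Definition no_permutation : Prop := forall k a, deg a = 1%g -> act k a = a.

(* Cohomologous [A]-valued 2-cochains on G, with G acting trivially on the
   group [A] of Abelian anyons. *)
Definition cohomologous (w w' : G -> G -> X) : Prop :=
  exists eps : G -> X, (forall k, abelian_anyon (eps k)) /\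
    forall k l, w k l =
      fprod (w' k l) (fprod (fprod (eps k) (eps l)) (dual (eps (k * l)%g))).

(* [w] is the cocycle obtained from a choice [O] of an Abelian defect in every
   sector. *)
Definition defect_cocycle (O : G -> X) (w : G -> G -> X) : Prop :=
  [/\ forall k, deg (O k) = k /\ abelian (O k),
      O 1%g = vac D,
      forall k l, abelian_anyon (w k l) &
      forall k l, fprod (O k) (O l) = fprod (w k l) (O (k * l)%g)].

Definition Iinv (n : nat) a : C :=
  twist a ^+ n * \prod_(j < n) eta a (deg a) (deg a ^+ j)%g.

Definition hall_conductivity (n : nat) a : R := arg01 (Iinv n a ^+ (2 * n)).

End Theory.

Section Magnetic.
Context {R : realType} {lB : R} (D : gxdata R (magtrans lB)).

(* The exponent is c - [c] with [c] the fractional part of c. *)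
Definition vison_cocycle (v : obj D) (g1 g2 : magtrans lB) : obj D :=
  fpow v (Num.floor
    (arg01 (val g1.1) + arg01 (val g2.1) + cocycle_phase lB g1.2 g2.2)).

Definition fractionalization_vison (v : obj D) : Prop :=
  exists O w, defect_cocycle O w /\ cohomologous w (vison_cocycle v).

Definition filling (n : nat) (a : obj D) (x y : R * R) : R :=
  arg01 ((eta a (mt_transl lB x) (mt_transl lB y)
          / eta a (mt_transl lB y) (mt_transl lB x)) ^+ n).

End Magnetic.

(* Main.v *)
Require Import Defs.
From mathcomp Require Import all_boot all_order all_algebra.
From mathcomp Require Import all_classical all_reals all_analysis complex.
From mathcomp Require Import ring lra.
Import Order.TTheory GRing.Theory Num.Theory.
Local Open Scope ring_scope.

(** For an Abelian anyon v, multiplying the two heptagon equations gives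
    M(v, ab) = M(v, a) M(v, b) eta_v(deg a, deg b) for Abelian defects a, b.

    Filling.  Applied to the defects 0_X, 0_Y of the two translations, this gives
    eta_v(X,Y) / eta_v(Y,X) = M(v, w(X,Y)) / M(v, w(Y,X)), which equals M(v, v)
    because the exponents of the vison cocycle are floor(1/2) = 0 and
    floor(-1/2) = -1.  Since g is central and w(g,k) = w(k,g), the group G fixes a,
    so the commutator of eta is multiplicative along the powers of a, and its n-th
    power at a is its value at v = a^n.

    Hall conductivity.  The heptagons for the triple (a, a^j, a) give
    M(v, a) W_g = R(a,a)^(2n) prod_j eta_a(g, g^j), where W_k = prod_j U_k(a, a^j).
    Then M(v, v) = M(v, a)^n prod_j eta_v(g, g^j), and eta_v is eta_a^n times the
    coboundary of W; as g^n = 1, the coboundary contributes exactly W_g^n, which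
    cancels the W_g above. *)

Set Implicit Arguments.
Unset Strict Implicit.
Unset Printing Implicit Defensive.

Local Notation iact k a := (act (k^-1)%g a).
(* finfun also exports an [fprod]. *)
Local Notation fprod := Defs.fprod.

(** * Phases modulo 1 *)

Section Expi.
Context {R : realType}.
Local Open Scope complex_scope.

(** [acos] only recovers angles of the upper half circle; the lower half is reached by reflecting t
    to 1 - t. *)
Lemma expi_surj (z : R[i]) : `|z| = 1 -> exists2 t : R, 0 <= t < 1 & expi t = z.
Proof.
case: z => x y; rewrite normc_def /= => /(congr1 (fun z => complex.Re z)) /= sq1.
have xy1 : x ^+ 2 + y ^+ 2 = 1.
  by rewrite -[LHS]sqr_sqrtr ?addr_ge0 ?sqr_ge0// sq1 expr1n.
have x1 : -1 <= x <= 1.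
  rewrite -ler_norml -(ler_pXn2r (n := 2))// ?nnegrE// real_normK ?num_real//.
  by rewrite expr1n -xy1 lerDl sqr_ge0.
have pi0 : 0 < pi :> R := pi_gt0 R.
have pi2 : pi != 0 :> R by rewrite gt_eqF.
have sE : sin (acos x) = `|y|.
  by rewrite sin_acos// -xy1 addrAC subrr add0r sqrtr_sqr.
have [y0|y0] := leP 0 y.
  exists (acos x / (2 * pi)).
    apply/andP; split; first by rewrite divr_ge0 ?acos_ge0// mulr_ge0// ltW.
    by rewrite ltr_pdivrMr ?mulr_gt0// mul1r; have := acos_lepi x1; lra.
  have e : 2 * pi * (acos x / (2 * pi)) = acos x.
    by rewrite mulrC divfK// mulf_neq0// pnatr_eq0.
  by rewrite /expi e acosK// sE ger0_norm.
(* The reflected angle must stay strictly below 1. A zero [acos x] would give [|y|] = sin 0 = 0,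
   against y < 0. *)
have acp : 0 < acos x.
  rewrite lt_neqAle acos_ge0// andbT; apply: contraTneq y0 => a0.
  by rewrite -leNgt -(normr0_eq0 (x := y)) ?lexx// -sE -a0 sin0.
exists (1 - acos x / (2 * pi)).
  apply/andP; split; last by rewrite gtrBl divr_gt0// mulr_gt0.
  by rewrite subr_ge0 ler_pdivrMr ?mulr_gt0// mul1r; have := acos_lepi x1; lra.
have e : 2 * pi * (1 - acos x / (2 * pi)) = pi *+ 2 - acos x.
  rewrite mulrBr mulr1 [_ * (_ / _)]mulrC divfK ?mulf_neq0 ?pnatr_eq0//.
  by rewrite mulr_natl.
by rewrite /expi e addrC cosD2pi sinD2pi cosN sinN acosK// sE ltr0_norm// opprK.
Qed.

Lemma expi_arg01 (z : R[i]) : `|z| = 1 -> expi (arg01 z) = z.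
Proof.
by case/expi_surj=> t t01 tz; rewrite /arg01; case: xgetP => [s _ []|/(_ t)[]].
Qed.

(** Uniqueness of the logarithm in [0,1) is needed only at 1, the U(1) component of a pure
    translation. *)
Lemma arg01_expi0 : arg01 (expi 0 : R[i]) = 0.
Proof.
rewrite /arg01; case: xgetP => [t _ [/andP[t0 t1]]|/(_ 0)[]]; last first.
  by split=> //; rewrite lexx ltr01.
rewrite expi0 /expi => /(congr1 (fun z => complex.Re z)) /= c1.
apply/eqP; rewrite eq_le t0 andbT leNgt; apply/negP => tp.
have sp : 0 < sin (pi * t).
  by apply: sin_gt0_pi; rewrite mulr_gt0 ?pi_gt0//= gtr_pMr ?pi_gt0.
(* The double angle formula turns cos (2 pi t) = 1 into sin (pi t) = 0. *)
move: c1; rewrite -mulrA mulr_natl cosD.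
have := cos2Dsin2 (pi * t); nra.
Qed.
End Expi.

(** * The group of Abelian objects *)

Section Abelian.
Context {R : realType} {G : groupType} {D : gxdata R G}.
Context (hD : gcrossed_btc D).
Local Notation X := (obj D).
Implicit Types (a b c d e f x : X) (g h k l : G).

Let hF := gx_fusion hD.
Let hd := gx_dim hD.
Let hA := gx_action hD.
Let hB := gx_braiding hD.
Let hP := gx_F hD.

Lemma big_sect_D1 {T : Type} {idx : T} {op : Monoid.com_law idx} c g (Phi : X -> T) :
  deg c = g -> (forall c', c' != c -> Phi c' = idx) ->
  \big[op/idx]_(c' <- sect D g) Phi c' = Phi c.
Proof.
move=> <- h; rewrite (bigD1_seq c) ?sect_uniq ?mem_sect//=.
by rewrite big1 ?Monoid.mulm1// => c' /h.
Qed.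

Lemma dual_vac : dual (vac D) = vac D.
Proof.
apply/eqP; have := N_vacl hF (vac D) (vac D).
by rewrite N_dual// eqxx eq_sym; case: eqP.
Qed.

Lemma N_vac : N (vac D) (vac D) (vac D) = 1%N.
Proof. by rewrite N_vacl// eqxx. Qed.

(** The axioms quantify over basis labels in ['I_(N a b c)]; this is the only label of a
    one-dimensional splitting space, with value 0. *)
Definition ord_of1 n (n1 : n = 1%N) : 'I_n := cast_ord (esym n1) ord0.

Lemma qdim_vac : qdim (vac D) = 1.
Proof.
rewrite /qdim dual_vac.
have /= -> := F_vac2 hP (ord_of1 N_vac) (ord_of1 N_vac).
by rewrite normr1 invr1.
Qed.

Lemma abelian_vac : abelian (vac D).
Proof. by rewrite /abelian qdim_vac. Qed.

Lemma abelian_dual a : abelian a -> abelian (dual a).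
Proof. by rewrite /abelian qdim_dual. Qed.

(* [dual a * a] has total dimension 1, and the vacuum already accounts for it. *)
Lemma N_dual_abelian a c : abelian a -> N (dual a) a c = (c == vac D).
Proof.
move=> /eqP aa.
have Nv : N (dual a) a (vac D) = 1%N by rewrite N_dual// dualK// eqxx.
have dv : deg (vac D) = (deg (dual a) * deg a)%g by apply: (N_deg hF); rewrite Nv.
have [->|cv] := eqVneq c (vac D); first exact: Nv.
apply/eqP; rewrite eqn0Ngt; apply/negP => Nc.
have := qdimM hd (dual a) a; rewrite qdim_dual// aa mulr1.
rewrite (bigD1_seq (vac D)) ?sect_uniq ?mem_sect ?dv//= Nv mul1r qdim_vac.
move/eqP; rewrite -subr_eq0 opprD addrA subrr sub0r oppr_eq0 psumr_eq0; last first.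
  by move=> x _; rewrite mulr_ge0 ?ler0n// ltW// qdim_gt0.
move/allP => /(_ c); rewrite mem_sect// (N_deg hF Nc) eqxx cv /=.
by move=> /(_ isT); rewrite mulf_eq0 pnatr_eq0 eqn0Ngt Nc gt_eqF ?qdim_gt0.
Qed.

Lemma fusion_channel a b : exists c, (0 < N a b c)%N.
Proof.
apply: contrapT => /forallNP h.
have := qdimM hd a b; rewrite big1 => [/eqP|c _].
  by rewrite mulf_eq0 !gt_eqF ?qdim_gt0.
by move: (h c) => /negP; rewrite -eqn0Ngt => /eqP ->; rewrite mul0r.
Qed.

(** Associativity for [dual a], [a], [b]: the other bracketing passes only through the vacuum. *)
Lemma sum_N_dual a b d : abelian a ->
  (\sum_(f <- sect D (deg a * deg b)%g) N a b f * N (dual a) f d = (b == d))%N.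
Proof.
move=> aa; have Nv : N (dual a) a (vac D) = 1%N by rewrite N_dual// dualK// eqxx.
have dv : deg (vac D) = (deg (dual a) * deg a)%g by apply: (N_deg hF); rewrite Nv.
rewrite -(N_assoc hF) (big_sect_D1 (c := vac D))// => [|c cv].
  by rewrite Nv mul1n N_vacl.
by rewrite N_dual_abelian// (negPf cv).
Qed.

(** Each channel of a * b contributes a positive integer to the sum of [sum_N_dual] at d = b. That
    sum is 1, so there is one channel, of multiplicity 1. *)
Lemma N_abelian_eq a b c c' : abelian a ->
  (0 < N a b c)%N -> (0 < N a b c')%N -> c' = c /\ N a b c = 1%N.
Proof.
move=> aa.
have pos e : (0 < N a b e)%N -> (0 < N a b e * N (dual a) e b)%N.
  move=> Ne; have [d Nd] := fusion_channel (dual a) e.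
  have [bd|bd] := eqVneq b d; first by rewrite {2}bd muln_gt0 Ne.
  have /eqP := sum_N_dual b d aa; rewrite (negPf bd) sum_nat_seq_eq0 => /allP /(_ e).
  rewrite mem_sect// (N_deg hF Ne) eqxx => /(_ isT) /=.
  by rewrite muln_eq0 !eqn0Ngt Ne Nd.
move=> Nc Nc'; have := sum_N_dual b b aa; rewrite eqxx.
rewrite (bigD1_seq c) ?sect_uniq ?mem_sect ?(N_deg hF Nc)//=.
have := pos _ Nc; case E: (N a b c * _)%N => [//|[|m]] _; last first.
  by rewrite !addSn.
move/eqP; rewrite add1n eqSS sum_nat_seq_eq0 => /allP /(_ c').
rewrite mem_sect// (N_deg hF Nc') eqxx => /(_ isT) h; split; last first.
  by apply/eqP; have /eqP := E; rewrite muln_eq1 => /andP[].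
apply/eqP; apply: contraLR (pos _ Nc') => ne; rewrite -eqn0Ngt.
by move: h; rewrite ne.
Qed.

Lemma N_abelian a b c : abelian a -> N a b c = (c == fprod a b).
Proof.
move=> aa; have [e Ne] := fusion_channel a b.
have he : forall c', (0 < N a b c')%N -> c' = e.
  by move=> c' /(N_abelian_eq aa Ne)[].
have : fprod a b \in [seq c <- sect D (deg a * deg b)%g | (0 < N a b c)%N].
  rewrite /fprod; set s := [seq _ <- _ | _].
  have : e \in s by rewrite mem_filter Ne mem_sect// (N_deg hF Ne) eqxx.
  by case: s => //= x s _; rewrite mem_head.
rewrite mem_filter => /andP[/[dup] Np /he ep _]; rewrite ep.
have [->|ne] := eqVneq c e; first by have [] := N_abelian_eq aa Ne Ne.
apply/eqP; rewrite eqn0Ngt; apply: contra ne => /he ->; exact: eqxx.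
Qed.

Lemma N_fprod a b : abelian a -> N a b (fprod a b) = 1%N.
Proof. by move=> aa; rewrite N_abelian// eqxx. Qed.

Lemma fprodP a b c : abelian a -> (0 < N a b c)%N -> fprod a b = c.
Proof. by move=> aa; rewrite N_abelian// lt0b => /eqP. Qed.

Lemma deg_fprod a b : abelian a -> deg (fprod a b) = (deg a * deg b)%g.
Proof. by move=> aa; apply: (N_deg hF); rewrite N_fprod. Qed.

Lemma abelian_fprod a b : abelian a -> abelian b -> abelian (fprod a b).
Proof.
move=> aa; have := qdimM hd a b; rewrite (eqP aa) mul1r.
rewrite (big_sect_D1 (c := fprod a b)) ?deg_fprod// => [|c ne].
  by rewrite N_fprod// mul1r /abelian => ->.
by rewrite N_abelian// (negPf ne) mul0r.
Qed.

Lemma fprod1x a : fprod (vac D) a = a.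
Proof. by apply: fprodP; rewrite ?abelian_vac// N_vacl// eqxx. Qed.

Lemma fprodx1 a : abelian a -> fprod a (vac D) = a.
Proof. by move=> aa; apply: fprodP => //; rewrite N_vacr// eqxx. Qed.

Lemma fprodVx a : abelian a -> fprod (dual a) a = vac D.
Proof.
by move=> aa; apply: fprodP; rewrite ?abelian_dual// N_dual_abelian// eqxx.
Qed.

Lemma fprodxV a : abelian a -> fprod a (dual a) = vac D.
Proof.
by move=> aa; apply: fprodP => //; rewrite N_dual// eqxx.
Qed.

Lemma fprodA a b c : abelian a -> abelian b ->
  fprod a (fprod b c) = fprod (fprod a b) c.
Proof.
move=> aa ab; have := N_assoc hF a b c (fprod (fprod a b) c).
rewrite (big_sect_D1 (c := fprod a b)) ?deg_fprod//; last first.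
  by move=> e ne; rewrite N_abelian// (negPf ne).
rewrite (big_sect_D1 (c := fprod b c)) ?deg_fprod//; last first.
  by move=> e ne; rewrite (N_abelian _ _ ab) (negPf ne).
rewrite !N_fprod// ?abelian_fprod// !mul1n => /esym N1.
by apply: fprodP; rewrite ?N1.
Qed.

Lemma fprodKl a b : abelian a -> fprod (dual a) (fprod a b) = b.
Proof. by move=> aa; rewrite fprodA ?abelian_dual// fprodVx// fprod1x. Qed.

Lemma fprod_inj a : abelian a -> injective (fprod a).
Proof. by move=> aa b c /(congr1 (fprod (dual a))); rewrite !fprodKl. Qed.

Lemma deg_dual a : abelian a -> deg (dual a) = (deg a)^-1%g.
Proof.
move=> aa; apply: (mulgI (deg a)).
by rewrite -deg_fprod// fprodxV// deg_vac// mulgV.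
Qed.

Lemma unitary_on_gt0 p q (A : nat -> nat -> R[i]) : unitary_on p q A ->
  (0 < q)%N -> (0 < p)%N.
Proof.
case=> _ + q0 => /(_ (Ordinal q0) (Ordinal q0)).
by case: p => //; rewrite big_ord0 eqxx => /esym/eqP; rewrite oner_eq0.
Qed.

Lemma unitary_on11 (A : nat -> nat -> R[i]) : unitary_on 1 1 A ->
  `|A 0%N 0%N| = 1.
Proof.
case=> /(_ ord0 ord0) + _; rewrite big_ord1 eqxx /= => h.
by apply/eqP; rewrite -sqrp_eq1// sqr_normc h.
Qed.

(** Crossed commutativity of fusion is not an axiom: it follows because the unitary [Rs a b c]
    identifies the two splitting spaces, so both are nonzero together. *)
Lemma fprod_crossed a b : abelian a -> abelian b ->
  fprod b (iact (deg b) a) = fprod a b.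
Proof.
move=> aa ab; apply: fprodP => //.
by apply: unitary_on_gt0 (R_unitary hB a b _) _; rewrite N_fprod.
Qed.

Lemma fprod_act k a b : abelian a -> abelian (act k a) ->
  act k (fprod a b) = fprod (act k a) (act k b).
Proof.
by move=> aa aka; apply/esym/fprodP; rewrite // N_act// N_fprod.
Qed.
End Abelian.

(** * Symbols on Abelian objects *)

Section Symbols.
Context {R : realType} {G : groupType} {D : gxdata R G}.
Context (hD : gcrossed_btc D).
Local Notation X := (obj D).
Implicit Types (a b c d e f x : X) (g h k l : G).

Let hA := gx_action hD.
Let hB := gx_braiding hD.
Let hP := gx_F hD.

Definition Fab a b c : R[i] :=
  F a b c (fprod (fprod a b) c) (fprod a b) 0 0 (fprod b c) 0 0.

Definition Uab k a b : R[i] := U k a b (fprod a b) 0 0.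

Lemma Fab_neq0 a b c : abelian a -> abelian b -> abelian c -> Fab a b c != 0.
Proof.
move=> aa ab ac; have aab := abelian_fprod hD aa ab.
have N1 := N_fprod hD b aa; have N2 := N_fprod hD c aab.
have N3 := N_fprod hD c ab.
have N4 : N a (fprod b c) (fprod (fprod a b) c) = 1%N.
  by rewrite -(fprodA hD)// N_fprod.
have := F_unitaryl hP (ord_of1 N1) (ord_of1 N2) (ord_of1 N1) (ord_of1 N2).
rewrite /= !eqxx (big_sect_D1 hD (c := fprod b c)) ?deg_fprod// => [|f ne].
  rewrite !N3 !N4 !big_ord1 /= => h; apply/eqP => F0.
  by move: h; rewrite -/(Fab a b c) F0 mul0r => /esym/eqP; rewrite oner_eq0.
by rewrite (N_abelian hD)// (negPf ne) big_ord0.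
Qed.

Lemma norm_Rab a b : abelian a -> abelian b -> `|Rab a b| = 1.
Proof.
move=> aa ab; have N1 := N_fprod hD b aa.
have N2 := N_fprod hD (iact (deg b) a) ab.
have := R_unitary hB a b (fprod a b).
by rewrite -{1}(fprod_crossed hD aa ab) N1 N2 => /unitary_on11.
Qed.

Lemma Rab_neq0 a b : abelian a -> abelian b -> Rab a b != 0.
Proof. by move=> aa ab; rewrite -normr_eq0 norm_Rab// oner_eq0. Qed.

(** Turns the conjugates in [heptagon2] into the inverses of the usual heptagon. *)
Lemma conj_Rab a b : abelian a -> abelian b -> (Rab a b)^*%C = (Rab a b)^-1.
Proof. by move=> aa ab; rewrite invc_norm norm_Rab// expr1n invr1 mul1r. Qed.

Lemma Uab_neq0 k a b : abelian a -> iact k a = a -> iact k b = b ->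
  Uab k a b != 0.
Proof.
move=> aa ka kb; have := U_unitary hA k a b (fprod a b).
rewrite (fprod_act hD) ?ka ?kb// N_fprod// => /unitary_on11 h.
by rewrite -normr_eq0 h oner_eq0.
Qed.

Lemma Uab1 a b : abelian a -> Uab 1%g a b = 1.
Proof.
by move=> aa; have := U_1 hA (ord_of1 (N_fprod hD b aa)) (ord_of1 (N_fprod hD b aa)).
Qed.

Lemma Rab_vacl a : Rab (vac D) a = 1.
Proof. by rewrite /Rab (fprod1x hD) R_vacl. Qed.

Lemma Rab_vacr a : abelian a -> Rab a (vac D) = 1.
Proof. by move=> aa; rewrite /Rab (fprodx1 hD)// R_vacr. Qed.

Lemma twist_Rab a : abelian a -> abelian (fprod a a) -> twist a = Rab a a.
Proof.
move=> aa aaa; rewrite /twist (big_sect_D1 hD (c := fprod a a)) ?deg_fprod//.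
  by rewrite N_fprod// big_ord1 (eqP aa) (eqP aaa) divr1 mul1r.
by move=> c ne; rewrite (N_abelian hD)// (negPf ne) big_ord0.
Qed.

(** Since [deg c] fixes a and b, fusion with c commutes, so both sides have the same channels; all
    splitting spaces are one-dimensional and each sum keeps one term. *)
Lemma heptagon1_abelian a b c : abelian a -> abelian b -> abelian c ->
  iact (deg c) a = a -> iact (deg c) b = b ->
  Rab a c * Fab a c b * Rab b c =
  Fab c a b * Uab (deg c) a b * Rab (fprod a b) c * Fab a b c.
Proof.
move=> aa ab ac ha hb; have aab := abelian_fprod hD aa ab.
have hab : iact (deg c) (fprod a b) = fprod a b.
  by rewrite (fprod_act hD) ?ha ?hb.
have ca : fprod c a = fprod a c by rewrite -{1}ha fprod_crossed.
have cb : fprod c b = fprod b c by rewrite -{1}hb fprod_crossed.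
have cab : fprod c (fprod a b) = fprod (fprod a b) c.
  by rewrite -{1}hab fprod_crossed.
have dE : fprod (fprod a c) b = fprod (fprod a b) c.
  by rewrite -cab (fprodA hD)// ca.
have N1 : N c a (fprod a c) = 1%N by rewrite -ca N_fprod.
have N1' := N_fprod hD c aa.
have N2 : N (fprod a c) b (fprod (fprod a b) c) = 1%N.
  by rewrite -dE N_fprod ?abelian_fprod.
have N3 := N_fprod hD c ab.
have N3' : N c b (fprod b c) = 1%N by rewrite -cb N_fprod.
have N4 : N a (fprod b c) (fprod (fprod a b) c) = 1%N.
  by rewrite -(fprodA hD)// N_fprod.
have N5 := N_fprod hD b aa.
have N6 := N_fprod hD c aab.
have N7 : N c (fprod a b) (fprod (fprod a b) c) = 1%N by rewrite -cab N_fprod.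
have := @heptagon1 _ _ _ hB a b c (fprod (fprod a b) c) (fprod a c) (fprod b c).
rewrite /= ha hb => /(_ (ord_of1 N1) (ord_of1 N2) (ord_of1 N3) (ord_of1 N4)) /=.
rewrite (big_sect_D1 hD (c := fprod a b)) ?deg_fprod//; last first.
  move=> f ne; rewrite big1// => s _; rewrite big1// => t _.
  by rewrite (N_abelian hD)// (negPf ne) big_ord0.
rewrite hab N1' N3' N5 N6 N7 !big_ord1 /=.
by rewrite /Rab /Fab /Uab ca cb dE.
Qed.

Lemma heptagon2_abelian a b c : abelian a -> abelian b -> abelian c ->
  iact (deg a) c = c -> iact (deg b) c = c ->
  (Rab c a)^-1 * Fab a c b * (Rab c b)^-1 =
  Fab c a b * eta c (deg a) (deg b) * (Rab c (fprod a b))^-1 * Fab a b c.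
Proof.
move=> aa ab ac ha hb; have aab := abelian_fprod hD aa ab.
have hab : iact (deg a * deg b)%g c = c by rewrite invgM (actM hA) ha hb.
have ca : fprod c a = fprod a c by rewrite -(fprod_crossed hD) ?ha.
have cb : fprod c b = fprod b c by rewrite -(fprod_crossed hD) ?hb.
have cab : fprod c (fprod a b) = fprod (fprod a b) c.
  by rewrite -(fprod_crossed hD)// deg_fprod// hab.
have dE : fprod (fprod c a) b = fprod (fprod a b) c.
  by rewrite -cab (fprodA hD).
have N1 := N_fprod hD a ac.
have N1' : N a c (fprod c a) = 1%N by rewrite ca N_fprod.
have N2 : N (fprod c a) b (fprod (fprod a b) c) = 1%N.
  by rewrite -dE N_fprod ?abelian_fprod.
have N3 := N_fprod hD c ab.
have N3' : N c b (fprod b c) = 1%N by rewrite -cb N_fprod.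
have N4 : N a (fprod b c) (fprod (fprod a b) c) = 1%N.
  by rewrite -(fprodA hD)// N_fprod.
have N5 := N_fprod hD b aa.
have N6 := N_fprod hD c aab.
have N7 : N c (fprod a b) (fprod (fprod a b) c) = 1%N by rewrite -cab N_fprod.
have := @heptagon2 _ _ _ hB a b c (fprod (fprod a b) c) (fprod c a) (fprod b c).
rewrite /= ha hab => /(_ (ord_of1 N1) (ord_of1 N2) (ord_of1 N3) (ord_of1 N4)) /=.
rewrite (big_sect_D1 hD (c := fprod a b)) ?deg_fprod//; last first.
  by move=> f ne; rewrite (N_abelian hD)// (negPf ne) big_ord0.
rewrite N1' N3' N5 N6 N7 !big_ord1 /=.
by rewrite -!conj_Rab// /Rab /Fab ca cb cab -dE ca.
Qed.

Lemma U_eta_abelian k l a b : abelian a ->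
  iact k a = a -> iact k b = b -> iact l a = a -> iact l b = b ->
  eta a k l * eta b k l * Uab l a b * Uab k a b =
  Uab (k * l)%g a b * eta (fprod a b) k l.
Proof.
move=> aa ka kb la lb.
have kla : iact (k * l)%g a = a by rewrite invgM (actM hA) ka la.
have klb : iact (k * l)%g b = b by rewrite invgM (actM hA) kb lb.
have klab : iact (k * l)%g (fprod a b) = fprod a b.
  by rewrite (fprod_act hD) ?kla ?klb.
have kab : iact k (fprod a b) = fprod a b by rewrite (fprod_act hD) ?ka ?kb.
have N1 := N_fprod hD b aa.
have := @U_eta _ _ _ hA k l a b (fprod a b); rewrite ka kb kla klb klab kab.
by move/(_ (ord_of1 N1) (ord_of1 N1)) => /=; rewrite N1 big_ord1.
Qed.

Lemma eta_neq0 a k l : eta a k l != 0.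
Proof. by rewrite -normr_eq0 eta_phase// oner_eq0. Qed.

(** * Monodromies of Abelian objects *)

Lemma monodromyC a b : monodromy a b = monodromy b a.
Proof. exact: mulrC. Qed.

Lemma monodromy_neq0 a b : abelian a -> abelian b -> monodromy a b != 0.
Proof. by move=> aa ab; rewrite mulf_neq0// Rab_neq0. Qed.

Lemma monodromy_vacr a : abelian a -> monodromy a (vac D) = 1.
Proof. by move=> aa; rewrite /monodromy Rab_vacl Rab_vacr// mulr1. Qed.

(* The product of the two heptagons: every F-symbol cancels, because [v] braids
   by the trivial group element. *)
Lemma monodromy_anyonM v a b : no_permutation D -> abelian_anyon v ->
  abelian a -> abelian b ->
  monodromy v (fprod a b) =
  monodromy v a * monodromy v b * eta v (deg a) (deg b).
Proof.
move=> hperm /andP[/eqP dv av] aa ab; have aab := abelian_fprod hD aa ab.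
have triv c : iact (deg v) c = c by rewrite dv invg1 (act1 hA).
have := heptagon1_abelian aa ab av (triv a) (triv b).
have := heptagon2_abelian aa ab av (hperm _ _ dv) (hperm _ _ dv).
rewrite dv Uab1// mulr1 /monodromy.
have F1 := Fab_neq0 aa ab av; have F2 := Fab_neq0 av aa ab.
have F3 := Fab_neq0 aa av ab.
have R1 := Rab_neq0 av aa; have R2 := Rab_neq0 av ab.
have R3 := Rab_neq0 av aab.
move=> h2 h1.
have -> : eta v (deg a) (deg b) = (Rab v a)^-1 * Fab a v b * (Rab v b)^-1
    * Rab v (fprod a b) / (Fab v a b * Fab a b v).
  by rewrite h2; field; rewrite F1 F2 R3.
have -> : Rab (fprod a b) v = Rab a v * Fab a v b * Rab b v
    / (Fab v a b * Fab a b v).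
  by rewrite h1; field; rewrite F1 F2.
by field; rewrite F1 F2 R1 R2.
Qed.

(* Here both heptagons pass [a] itself through [a * b]; the symbols
   [F a b a] cancel and [Uab] is the only remnant of the crossing. *)
Lemma monodromy_selfM a b : abelian a -> abelian b ->
  iact (deg a) a = a -> iact (deg a) b = b -> iact (deg b) a = a ->
  monodromy (fprod a b) a * Uab (deg a) a b =
  Rab a a ^+ 2 * monodromy b a * eta a (deg a) (deg b).
Proof.
move=> aa ab haa hab hba; have aab := abelian_fprod hD aa ab.
have := heptagon1_abelian aa ab aa haa hab.
have := heptagon2_abelian aa ab aa haa hba.
have F1 := Fab_neq0 aa ab aa; have F2 := Fab_neq0 aa aa ab.
have R1 := Rab_neq0 aa aa; have R2 := Rab_neq0 aa ab.
have R3 := Rab_neq0 aa aab; have R4 := Rab_neq0 ab aa.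
move=> h2 h1; rewrite /monodromy.
have -> : eta a (deg a) (deg b) = (Rab a a)^-1 * (Rab a b)^-1
    * Rab a (fprod a b) / Fab a b a.
  apply: (mulfI F2); apply: (mulIf F1); apply: (mulIf (invr_neq0 R3)).
  by rewrite mulrAC -h2; field; rewrite F1 R1 R2 R3.
have -> : Rab (fprod a b) a * Rab a (fprod a b) * Uab (deg a) a b =
    (Fab a a b * Uab (deg a) a b * Rab (fprod a b) a * Fab a b a)
    * Rab a (fprod a b) / (Fab a a b * Fab a b a).
  by field; rewrite F1 F2.
by rewrite -h1; field; rewrite F1 F2 R1 R2.
Qed.

End Symbols.

(** * Powers of an Abelian defect fixed by G *)

Section Powers.
Context {R : realType} {G : groupType} {D : gxdata R G}.
Context (hD : gcrossed_btc D) (hperm : no_permutation D).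
Context (a : obj D) (aa : abelian a) (act_a : forall k, act k a = a).
Local Notation pow n := (iter n (fprod a) (vac D)).
Local Notation g := (deg a).

(** The action phases accumulated in fusing n copies of [a]. As a function of k, this is the cochain
    whose coboundary separates [eta] at the n-th power of [a] from the n-th power of [eta a]. *)
Definition Uprod n k : R[i] := \prod_(j < n) Uab k a (pow j).

Definition eta_prod n (x : obj D) : R[i] := \prod_(j < n) eta x g (g ^+ j)%g.

Lemma abelian_pow n : abelian (pow n).
Proof.
by elim: n => [|n IH] /=; [exact: abelian_vac|exact: abelian_fprod].
Qed.

Lemma deg_pow n : deg (pow n) = (g ^+ n)%g.
Proof.
elim: n => [|n IH] /=; first exact: deg_vac (gx_fusion hD).
by rewrite deg_fprod// IH expgS.
Qed.

Lemma act_pow n k : act k (pow n) = pow n.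
Proof.
elim: n => [|n IH] /=; last by rewrite (fprod_act hD) ?act_a// IH.
by apply: hperm; apply: deg_vac (gx_fusion hD).
Qed.

Lemma Uprod_neq0 n k : Uprod n k != 0.
Proof.
by apply/prodf_neq0 => j _; apply: (Uab_neq0 hD); rewrite ?act_a ?act_pow.
Qed.

Lemma Uprod1 n : Uprod n 1%g = 1.
Proof. by apply: big1 => j _; apply: (Uab1 hD). Qed.

(** Induction on n, with [monodromy_selfM] moving one further copy of [a] past the power. *)
Lemma monodromy_pow_self n :
  monodromy (pow n) a * Uprod n g = Rab a a ^+ (2 * n) * eta_prod n a.
Proof.
rewrite /Uprod /eta_prod; elim: n => [|n IH].
  by rewrite !big_ord0 muln0 expr0 monodromyC monodromy_vacr.
rewrite !big_ord_recr /= mulnS exprD.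
have := monodromy_selfM hD aa (abelian_pow n) (act_a _) (act_pow _ _) (act_a _).
rewrite deg_pow => h.
rewrite mulrCA h.
rewrite [LHS](_ : _ = Rab a a ^+ 2 * eta a g (g ^+ n)%g *
  (monodromy (pow n) a * \prod_(j < n) Uab g a (pow j))); last by ring.
by rewrite IH; ring.
Qed.

Lemma monodromy_anyonX v n : abelian_anyon v ->
  monodromy v (pow n) = monodromy v a ^+ n * eta_prod n v.
Proof.
move=> hv; rewrite /eta_prod; elim: n => [|n IH].
  by rewrite big_ord0 expr0 mulr1 monodromy_vacr//; case/andP: hv.
rewrite big_ord_recr /= (monodromy_anyonM hD)// ?abelian_pow//.
by rewrite IH deg_pow exprS -!mulrA.
Qed.

Lemma eta_pow n k l :
  eta (pow n) k l * Uprod n (k * l)%g = eta a k l ^+ n * Uprod n k * Uprod n l.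
Proof.
rewrite /Uprod; elim: n => [|n IH].
  by rewrite !big_ord0 expr0 !mulr1 /= (eta_vac (gx_action hD)).
rewrite !big_ord_recr exprS /=.
have := U_eta_abelian hD aa (act_a (k^-1)%g) (act_pow n (k^-1)%g)
  (act_a (l^-1)%g) (act_pow n (l^-1)%g) => h.
rewrite mulrCA [eta (fprod _ _) _ _ * _]mulrC -h.
transitivity ((eta a k l * Uab l a (pow n) * Uab k a (pow n)) *
  (eta (pow n) k l * \prod_(i < n) Uab (k * l)%g a (pow i))); first by ring.
by rewrite IH; ring.
Qed.

(** The coboundaries of [eta_pow] at the pairs (g, g^j) telescope, leaving m factors [Uprod n g]
    against one at g^m. *)
Lemma eta_prod_pow n m : eta_prod m (pow n) * Uprod n (g ^+ m)%g =
  eta_prod m a ^+ n * Uprod n g ^+ m.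
Proof.
rewrite /eta_prod; elim: m => [|m IH].
  by rewrite !big_ord0 expg0 Uprod1 expr1n mulr1.
rewrite !big_ord_recr /= expgS -mulrA eta_pow exprMn exprS.
transitivity (eta a g (g ^+ m) ^+ n * Uprod n g *
  (\prod_(i < m) eta (pow n) g (g ^+ i) * Uprod n (g ^+ m)%g)); first by ring.
by rewrite IH; ring.
Qed.

Lemma Iinv_monodromy n : abelian_anyon (pow n) ->
  Iinv n a ^+ (2 * n) = monodromy (pow n) (pow n).
Proof.
move=> hv; rewrite monodromy_anyonX//.
(* The n-th power of [a] is an anyon, so g^n = 1 and the far end of the telescope is trivial. *)
have gn : (g ^+ n)%g = 1%g by rewrite -deg_pow; case/andP: hv => /eqP.
have := eta_prod_pow n n; rewrite gn Uprod1 mulr1 => ->.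
rewrite /Iinv (twist_Rab hD) ?abelian_fprod// -/(eta_prod n a).
(* Each [Uprod n g] is absorbed by a monodromy of v with [a]. That yields a second [eta_prod n a],
   which completes the square of [Iinv n a]. *)
rewrite mulrCA -exprMn monodromy_pow_self -exprMn.
by rewrite exprM mulnC exprM; congr (_ ^+ n); ring.
Qed.

(** For commuting k and l the coboundary of [Uprod n] is symmetric and drops out of the ratio. *)
Lemma eta_commutator_pow n k l : (k * l = l * k)%g ->
  (eta a k l / eta a l k) ^+ n = eta (pow n) k l / eta (pow n) l k.
Proof.
move=> kl; have h1 := eta_pow n k l; have h2 := eta_pow n l k.
have e1 := eta_neq0 hD a l k; have e2 := eta_neq0 hD (pow n) l k.
apply/eqP; rewrite expr_div_n eqr_div ?expf_neq0//; apply/eqP.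
apply: (mulIf (Uprod_neq0 n (k * l)%g)).
rewrite -mulrA {1}kl h2 [RHS]mulrAC h1; ring.
Qed.

End Powers.

(** * Symmetry fractionalization *)

Section Fractionalization.
Context {R : realType} {G : groupType} {D : gxdata R G}.
Context (hD : gcrossed_btc D) (hperm : no_permutation D).
Implicit Types (a b s t v : obj D) (k l : G).

Lemma abelian_anyon_fprod s t : abelian_anyon s -> abelian_anyon t ->
  abelian_anyon (fprod s t).
Proof.
move=> /andP[/eqP ds ss] /andP[/eqP dt tt]; apply/andP; split.
  by rewrite deg_fprod// ds dt mulg1.
exact: abelian_fprod.
Qed.

Lemma abelian_anyon_vac : abelian_anyon (vac D).
Proof. by rewrite /abelian_anyon (deg_vac (gx_fusion hD)) eqxx (abelian_vac hD). Qed.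

Lemma abelian_anyon_dual s : abelian_anyon s -> abelian_anyon (dual s).
Proof.
move=> /andP[/eqP ds ss]; rewrite /abelian_anyon deg_dual// ds invg1 eqxx.
exact: abelian_dual.
Qed.

Lemma abelian_anyon_fpow v m : abelian_anyon v -> abelian_anyon (fpow v m).
Proof.
move=> hv; have hv' := abelian_anyon_dual hv.
have h u j : abelian_anyon u -> abelian_anyon (iter j (fprod u) (vac D)).
  move=> hu; elim: j => [|j IH] /=; first exact: abelian_anyon_vac.
  exact: abelian_anyon_fprod.
by case: m => j; apply: h.
Qed.

Lemma fprod_anyonC s a : abelian_anyon s -> abelian a -> fprod a s = fprod s a.
Proof.
by move=> /andP[/eqP ds ss] aa; rewrite -(fprod_crossed hD ss aa) hperm.
Qed.

Lemma monodromy_anyonMl v s a : abelian_anyon v -> abelian_anyon s ->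
  abelian a -> monodromy v (fprod s a) = monodromy v s * monodromy v a.
Proof.
move=> hv /andP[/eqP ds ss] aa.
by rewrite monodromy_anyonM// ds (eta_1l (gx_action hD)) mulr1.
Qed.

(** Crossed braiding past [O k] replaces [a] by its image under k^-1, while symmetry of [w] makes
    [a] and [O k] commute under fusion; cancelling [O k] identifies the two. *)
Lemma act_fixed (O : G -> obj D) w a k : defect_cocycle O w -> abelian a ->
  (deg a * k = k * deg a)%g -> w (deg a) k = w k (deg a) -> act k a = a.
Proof.
case=> hO _ hw Ow aa gk wk.
have dO j : deg (O j) = j by case: (hO j).
have aO j : abelian (O j) by case: (hO j).
set g := deg a in gk wk; pose s := fprod a (dual (O g)).
have hs : abelian_anyon s.
  rewrite /abelian_anyon deg_fprod// deg_dual// dO mulgV eqxx /=.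
  by rewrite abelian_fprod// abelian_dual.
(* [a] and the chosen defect [O g] lie in the same sector, so they differ by an Abelian anyon s. *)
have aE : a = fprod s (O g).
  by rewrite /s -fprodA ?abelian_dual// fprodVx// fprodx1.
have as_ : abelian s by case/andP: hs.
have comm : fprod (O k) a = fprod a (O k).
  rewrite {1}aE fprodA// (fprod_anyonC hs)// -fprodA// Ow -gk -wk -Ow.
  by rewrite fprodA// -aE.
have fx : iact k a = a.
  by apply: (fprod_inj hD (aO k)); rewrite comm -(fprod_crossed hD aa (aO k)) dO.
by rewrite -{1}fx -(actM (gx_action hD)) mulgV (act1 (gx_action hD)).
Qed.

Lemma cohomologous_sym (w w' : G -> G -> obj D) k l : cohomologous w w' ->
  (k * l = l * k)%g -> w' k l = w' l k -> w k l = w l k.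
Proof.
case=> eps [heps wE] kl w'kl; rewrite !wE w'kl kl; congr (fprod _ (fprod _ _)).
by apply: fprod_anyonC => //; case/andP: (heps k).
Qed.

(** Solving [monodromy_anyonM] for [eta] on the defects O expresses it through monodromies of v; the
    commutator then sees only the cohomology class of [w]. *)
Lemma eta_commutator v (O : G -> obj D) w w' k l :
  abelian_anyon v -> defect_cocycle O w ->
  cohomologous w w' -> (forall j m, abelian_anyon (w' j m)) ->
  (k * l = l * k)%g ->
  eta v k l / eta v l k = monodromy v (w' k l) / monodromy v (w' l k).
Proof.
move=> hv [hO _ hw Ow] [eps [heps wE]] hw' kl.
have dO j : deg (O j) = j by case: (hO j).
have aO j : abelian (O j) by case: (hO j).
have av : abelian v by case/andP: hv.
have etaE j m : eta v j m = monodromy v (w' j m)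
    * (monodromy v (eps j) * monodromy v (eps m)
       * monodromy v (dual (eps (j * m)%g))
       * monodromy v (O (j * m)%g) / (monodromy v (O j) * monodromy v (O m))).
  have := monodromy_anyonM hD hperm hv (aO j) (aO m).
  have ej : abelian (eps j) by case/andP: (heps j).
  have he : abelian_anyon (fprod (eps j) (eps m)) by apply: abelian_anyon_fprod.
  have hd := abelian_anyon_dual (heps (j * m)%g).
  have hed := abelian_anyon_fprod he hd.
  rewrite !dO Ow (monodromy_anyonMl hv)// wE (monodromy_anyonMl hv)//; last first.
    by case/andP: hed.
  rewrite (monodromy_anyonMl hv)//; last by case/andP: hd.
  rewrite (monodromy_anyonMl hv)//; last by case/andP: (heps m).
  move=> h; have n1 := monodromy_neq0 hD av (aO j).
  have n2 := monodromy_neq0 hD av (aO m).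
  apply: (mulfI (mulf_neq0 n1 n2)); rewrite -h.
  by field; rewrite n1 n2.
(* The long factor in [etaE] is symmetric under exchange of the commuting k and l, and nonzero, so
   it cancels. *)
rewrite !etaE -kl [monodromy v (eps l) * _]mulrC [monodromy v (O l) * _]mulrC.
rewrite -mulf_div divff ?mulr1//.
have nz s : abelian_anyon s -> monodromy v s != 0.
  by case/andP=> _ ?; apply: monodromy_neq0.
have hd := nz _ (abelian_anyon_dual (heps (k * l)%g)).
have nO j := monodromy_neq0 hD av (aO j).
apply: (mulf_neq0 (mulf_neq0 (mulf_neq0 (mulf_neq0 _ _) hd) (nO _)));
  [exact: nz|exact: nz|exact: invr_neq0 (mulf_neq0 (nO _) (nO _))].
Qed.

End Fractionalization.

(** * The magnetic translation group *)

Section MagneticTranslationGroup.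
Context {R : realType} {lB : R}.

Lemma cocycle_phase_sym (g k : magtrans lB) : g.2 = 0 ->
  cocycle_phase lB g.2 k.2 = cocycle_phase lB k.2 g.2.
Proof. by move=> ->; rewrite /cocycle_phase /cross /= !(mul0r, mulr0). Qed.

Lemma mt_rot_central t (k : magtrans lB) :
  (mt_rot lB t * k = k * mt_rot lB t)%g.
Proof.
apply: mt_eqP; last exact: addrC.
rewrite /= (@cocycle_phase_sym (mt_rot lB t) k)//; congr (_ * _); exact: mulrC.
Qed.

Lemma cocycle_phase_cell (x y : R * R) : lB != 0 -> cross x y = lB ^+ 2 ->
  cocycle_phase lB x y = 2^-1 /\ cocycle_phase lB y x = - 2^-1.
Proof.
move=> lB0 xy; rewrite /cocycle_phase.
have -> : cross y x = - cross x y by rewrite /cross; ring.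
by rewrite xy; split; field; rewrite lB0.
Qed.

(** The phases of the two orders, 1/2 and -1/2, differ by an integer: the cell encloses one flux
    quantum. *)
Lemma mt_transl_comm (x y : R * R) : lB != 0 -> cross x y = lB ^+ 2 ->
  (mt_transl lB x * mt_transl lB y = mt_transl lB y * mt_transl lB x)%g.
Proof.
move=> lB0 xy; have [p1 p2] := cocycle_phase_cell lB0 xy.
apply: mt_eqP; last exact: addrC.
rewrite /= p1 p2; congr (_ * _).
have half : 2^-1 = - 2^-1 + 1 :> R by lra.
rewrite {1}half expiD; have -> : expi (1 : R) = 1; last by rewrite mulr1.
by rewrite /expi mulr1 mulr_natl cos2pi sin2pi.
Qed.

End MagneticTranslationGroup.

Theorem mainTheorem10 (R : realType) (lB : R) (hlB : 0 < lB)
  (D : gxdata R (magtrans lB)) (hD : gcrossed_btc D) (hmod : modular D)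
  (hperm : no_permutation D)
  (v : obj D) (hv : abelian_anyon v) (hfrac : fractionalization_vison v)
  (n : nat) (hn : (0 < n)%N)
  (a : obj D) (hga : deg a = mt_rot lB n%:R^-1) (ha : abelian a)
  (hav : fpow a n = v)
  (x y : R * R) (hxy : cross x y = lB ^+ 2) :
  expi (filling n a x y) = monodromy v v /\
  monodromy v v = expi (hall_conductivity n a).
Proof.
case: hfrac => O [w [hO hw]].
have lB0 : lB != 0 by rewrite gt_eqF.
have av : abelian v by case/andP: hv.
(* The translation part of [deg a] is zero, so its cross products vanish and the vison exponent is
   symmetric in [deg a] and k. *)
have act_a k : act k a = a.
  have gk : (deg a * k = k * deg a)%g by rewrite hga mt_rot_central.
  apply: (act_fixed hD hperm hO) => //.
  apply: (cohomologous_sym hD hperm hw gk); rewrite /vison_cocycle.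
  rewrite cocycle_phase_sym ?hga//; congr (fpow v (Num.floor (_ + _))).
  exact: addrC.
(* On a phase [arg01] is a genuine logarithm, which [expi] inverts. *)
have normM : `|monodromy v v| = 1 by rewrite normrM !(norm_Rab hD)// mulr1.
have powE : iter n (fprod a) (vac D) = v := hav.
have etaM : (eta a (mt_transl lB x) (mt_transl lB y)
    / eta a (mt_transl lB y) (mt_transl lB x)) ^+ n = monodromy v v.
  have xyC := mt_transl_comm lB0 hxy.
  have hvis j m : abelian_anyon (vison_cocycle v j m) by apply: abelian_anyon_fpow.
  rewrite (eta_commutator_pow hD hperm ha act_a n xyC) powE.
  rewrite (eta_commutator hD hperm hv hO hw hvis xyC).
  have [p1 p2] := cocycle_phase_cell lB0 hxy.
  rewrite /vison_cocycle /= arg01_expi0 !add0r p1 p2.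
  rewrite (floor_def (m := 0)); last by rewrite add0r; lra.
  (* [Negz 0] is -1, so the second cocycle value is [dual v], whereas the first is the vacuum. *)
  rewrite (floor_def (m := Negz 0)); last by rewrite NegzE; lra.
  rewrite [fpow v 0]/= monodromy_vacr// mul1r /= fprodx1 ?abelian_dual//.
  (* As v * [dual v] is the vacuum, the inverse of the monodromy of v with [dual v] is that of v
     with itself. *)
  have := monodromy_anyonMl hD hperm hv hv (abelian_dual hD av).
  rewrite fprodxV// monodromy_vacr// => h.
  have M0 := monodromy_neq0 hD av (abelian_dual hD av).
  by apply: (mulIf M0); rewrite mulVf// h.
have IM : Iinv n a ^+ (2 * n) = monodromy v v.
  by have := Iinv_monodromy hD hperm ha act_a (n := n); rewrite powE; apply.
rewrite /filling /hall_conductivity etaM IM.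
by split; rewrite expi_arg01.
Qed.
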